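(* Let $n\ge 5$. In the endomorphism monoid $\mathcal{E}_n=\mathrm{End}(\mathcal{T}_n)$, with $\mathcal{G}_n=\mathrm{Aut}(\mathcal{T}_n)$: (1) each element of $E_3$ is a left identity of $\mathcal{E}_n\setminus\mathcal{G}_n$; (2) each element of $E_1$ is a right zero of $\mathcal{E}_n\setminus\mathcal{G}_n$; (3) the minimal ideal of $\mathcal{E}_n$ is $E_1$; (4) the set of all singular idempotents $E_3\cup E_2\cup E_1$ forms a left ideal of $\mathcal{E}_n$; (5) the set of all idempotents $E=\{\varepsilon\}\cup E_3\cup E_2\cup E_1$ is a band, and forms a chain of right-zero semigroups.
   Context: Maps are written on the right and composed left to right ($\alpha\beta$ means first $\alpha$, then $\beta$). $\mathcal{T}_n$ is the full transformation semigroup of all maps $\{1,\dots,n\}\to\{1,\dots,n\}$; $\mathcal{S}_n$ is the symmetric group, $\mathcal{A}_n$ the alternating group, $\mathrm{id}$ the identity map. For $g\in\mathcal{S}_n$, $s\in\mathcal{T}_n$ put $s^g=g^{-1}sg$. $\mathcal{E}_n=\mathrm{End}(\mathcal{T}_n)$ is the monoid of all semigroup endomorphisms of $\mathcal{T}_n$ (not required to fix $\mathrm{id}$) under composition, $\mathcal{G}_n=\mathrm{Aut}(\mathcal{T}_n)$, and $\varepsilon$ is the identity of $\mathcal{E}_n$. Elements of $\mathcal{E}_n\setminus\mathcal{G}_n$ are called singular. For $g\in\mathcal{S}_n$, $\psi_g$ is the map $s\mapsto s^g$. For $t,e\in\mathcal{T}_n$, $\phi_{t,e}$ is the map on $\mathcal{T}_n$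 sending $s\mapsto t$ if $s\in\mathcal{S}_n\setminus\mathcal{A}_n$, $s\mapsto t^2$ if $s\in\mathcal{A}_n$, and $s\mapsto e$ if $s\in\mathcal{T}_n\setminus\mathcal{S}_n$. By a known theorem of Schein and Teclezghi, $\mathcal{G}_n=\{\psi_g:g\in\mathcal{S}_n\}$ and, for $n\ne 4$, $\mathcal{E}_n=\mathcal{G}_n\cup\{\phi_{t,e}: t,e\in\mathcal{T}_n,\ t^3=t,\ te=et=e^2=e\}$. Define $E_3=\{\phi_{t,e}\in\mathcal{E}_n: t\in\mathcal{S}_n\setminus\mathcal{A}_n,\ e\ne\mathrm{id}\}$, $E_2=\{\phi_{\mathrm{id},e}\in\mathcal{E}_n: e\neq\mathrm{id}\}$, $E_1=\{\phi_{e,e}\in\mathcal{E}_n\}$. (For $k=1,2,3$, $E_k$ is the set of idempotents of $\mathcal{E}_n$ whose image has cardinality $k$.) A left identity of a semigroup $S$ is an element $e$ with $ea=a$ for all $a\in S$; a right zero is an element $e$ with $ae=e$ for all $a\in S$. A right-zero semigroup is one all of whose elements are right zeros. A band is a semigroup consisting of idempotents. A semigroup $S$ is a semilattice $Y$ of subsemigroups $S_i$ ($i\in Y$) if $S$ is the disjoint union of the $S_i$ and $S_iS_j\subseteq S_{i\wedge j}$ for all $i,j\in Y$; it is a chain of these subsemigroups if $Y$ is linearly ordered. Here the components are $E_1<E_2<E_3<\{\varepsilon\}$. *)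

(* Defs.v *)
From HB Require Import structures.
From mathcomp Require Import all_boot all_order all_fingroup all_solvable.

Set Implicit Arguments.
Unset Strict Implicit.
Unset Printing Implicit Defensive.

Local Open Scope group_scope.

(* [transf T] is the full transformation monoid of T with maps written on the
   right: in [s * t], s is applied first. It is used both for T_n, with
   T := 'I_n, and for the self-maps of T_n, with T := T_n, among which the
   endomorphisms live. *)
Definition transf (T : finType) : Type := {ffun T -> T}.

Section Transf.
Variable T : finType.

HB.instance Definition _ := Finite.on (transf T).

Definition transf_one : transf T := [ffun x => x].
Definition transf_mul (s t : transf T) : transf T := [ffun x => t (s x)].

Fact transf_mulA : associative transf_mul.
Proof. by move=> s t u; apply/ffunP=> x; rewrite !ffunE. Qed.

Fact transf_mul1 : left_id transf_one transf_mul.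
Proof. by move=> s; apply/ffunP=> x; rewrite !ffunE. Qed.

Fact transf_mulr1 : right_id transf_one transf_mul.
Proof. by move=> s; apply/ffunP=> x; rewrite !ffunE. Qed.

HB.instance Definition _ :=
  isMonoid.Build (transf T) transf_mulA transf_mul1 transf_mulr1.

Definition transf_of_perm (g : {perm T}) : transf T := [ffun x => g x].

Definition perm_transf : {set transf T} :=
  [set transf_of_perm g | g in 'Sym_T].
Definition even_transf : {set transf T} :=
  [set transf_of_perm g | g in 'Alt_T].

End Transf.

(* Semigroups occur as subsets S of an ambient semigroup M; subsemigroups and
   ideals are nonempty. *)
Section Semigroups.
Variable M : semigroupType.
Implicit Types S L I : {pred M}.

Definition subsemigroup S : Prop :=
  (exists x, x \in S) /\ {in S &, forall x y, x * y \in S}.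

Definition left_identity_of S (e : M) : Prop :=
  e \in S /\ {in S, forall a, e * a = a}.

Definition right_zero_of S (e : M) : Prop :=
  e \in S /\ {in S, forall a, a * e = e}.

Definition left_ideal_of S L : Prop :=
  [/\ exists x, x \in L, {subset L <= S} &
      {in S & L, forall a x, a * x \in L}].

Definition ideal_of S I : Prop :=
  [/\ exists x, x \in I, {subset I <= S},
      {in S & I, forall a x, a * x \in I} &
      {in S & I, forall a x, x * a \in I}].

Definition minimal_ideal_of S I : Prop :=
  ideal_of S I /\
  forall J : {pred M}, ideal_of S J -> {subset J <= I} -> J =i I.

Definition right_zero_semigroup S : Prop :=
  subsemigroup S /\ {in S, forall e, right_zero_of S e}.

Definition band S : Prop :=
  subsemigroup S /\ {in S, forall x, x * x = x}.

Definition semilattice_of_subsemigroups d (Y : meetSemilatticeType d)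
    S (C : Y -> {pred M}) : Prop :=
  [/\ forall i, subsemigroup (C i),
      forall x, x \in S <-> exists i, x \in C i,
      forall i j x, x \in C i -> x \in C j -> i = j &
      forall i j x y, x \in C i -> y \in C j -> x * y \in C (Order.meet i j)].

Definition chain_of_subsemigroups d (Y : orderType d)
    S (C : Y -> {pred M}) : Prop :=
  semilattice_of_subsemigroups S C.

End Semigroups.

Notation Tn n := (transf 'I_n).

Section EndomorphismMonoid.
Variable n : nat.

Definition End_T : {set transf (Tn n)} :=
  [set a : transf (Tn n) |
    [forall s : Tn n, forall t : Tn n, a (s * t) == a s * a t]].
Definition Aut_T : {set transf (Tn n)} := End_T :&: perm_transf (Tn n).

Definition phi (t e : Tn n) : transf (Tn n) :=
  [ffun s : Tn n =>
    if s \in perm_transf 'I_n :\: even_transf 'I_n then t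
    else if s \in even_transf 'I_n then t * t
    else e].

Definition E3 : {set transf (Tn n)} :=
  [set a in End_T | [exists t : Tn n, exists e : Tn n,
    [&& t \in perm_transf 'I_n :\: even_transf 'I_n, e != 1 & a == phi t e]]].
Definition E2 : {set transf (Tn n)} :=
  [set a in End_T | [exists e : Tn n, (e != 1) && (a == phi 1 e)]].
Definition E1 : {set transf (Tn n)} :=
  [set a in End_T | [exists e : Tn n, a == phi e e]].

(* The components indexed by the linearly ordered set 'I_4, in the order
   E1 < E2 < E3 < {1}. *)
Definition E_component (i : 'I_4) : {set transf (Tn n)} :=
  tnth [tuple E1; E2; E3; [set (1 : transf (Tn n))]] i.

End EndomorphismMonoid.

(* Main.v *)
Require Import Defs.
From mathcomp Require Import all_boot all_order all_fingroup all_solvable.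

Local Open Scope group_scope.

(** Everything rests on the shape of the non-injective endomorphisms [a] of T_n
    for n >= 5: each one is some [phi t e].

    The constant maps are the right zeros of T_n, and [a] identifies all of
    them as soon as it identifies two distinct maps ([End_constant]); their
    common image [e] is then a zero of the image of [a].  Hence the
    permutations induced by the [a g], for g in S_n, on the image of the
    idempotent [a 1] all fix the points in the image of [e].  As S_n is too
    large to embed in the stabiliser of a point, [a] is not injective on S_n
    ([End_noninj_perm]), and simplicity of A_n puts A_n into the kernel
    ([Alt_sub_End_kernel]).  It follows that [a] cannot tell apart two
    idempotents of rank n - 1, since A_n conjugates any one to any other.  A
    non-permutation s absorbs one such idempotent on its left, so [a s] absorbs
    the image of every product of them, and constants are such products:
    [a s = e] ([End_nonperm]).  What remains is that [a] factors through the
    sign on S_n, and this is [End_noninj_phi].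

    The claims on idempotents are then short computations from the rule
    [phi t e * b = phi (b t) (b e)] ([phi_mul]).  The singular idempotents are
    the endomorphisms [phi t e] with t odd, t = 1 or t = e ([singular_idemP]).
    For the left ideal property, a product [a * b] with b of this kind is not
    injective, so it is again a [phi t' e'], and t' and e' lie in the image
    {t, t^2, e} of b; this applies whether or not a is an automorphism.  An
    injective endomorphism is a permutation of T_n, and its
    only idempotent is the identity. *)

Set Implicit Arguments.
Unset Strict Implicit.
Unset Printing Implicit Defensive.

(** * Permutations, constants and collapsing maps *)

Section Transformations.
Variable T : finType.
Implicit Types (s t : transf T) (g h : {perm T}) (x y z : T).

Lemma transfM s t x : (s * t) x = t (s x).
Proof. by rewrite ffunE. Qed.

Lemma transf1 x : (1 : transf T) x = x.
Proof. by rewrite ffunE. Qed.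

Lemma transf_of_permM g h :
  transf_of_perm (g * h) = transf_of_perm g * transf_of_perm h.
Proof. by apply/ffunP=> x; rewrite transfM !ffunE permM. Qed.

Lemma transf_of_perm1 : transf_of_perm (1 : {perm T}) = 1.
Proof. by apply/ffunP=> x; rewrite !ffunE perm1. Qed.

Lemma transf_of_perm_inj : injective (@transf_of_perm T).
Proof.
by move=> g h /ffunP eq_gh; apply/permP=> x; have:= eq_gh x; rewrite !ffunE.
Qed.

Lemma mem_perm_transf s : (s \in perm_transf T) = injectiveb s.
Proof.
apply/imsetP/injectiveP=> [[g _ ->] x y | inj_s].
  by rewrite !ffunE; apply: perm_inj.
by exists (perm inj_s); rewrite ?inE //; apply/ffunP=> x; rewrite ffunE permE.
Qed.

Lemma transf_of_perm_in g : transf_of_perm g \in perm_transf T.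
Proof. by apply/imset_f; rewrite inE. Qed.

Lemma mem_even_transf g : (transf_of_perm g \in even_transf T) = ~~ odd_perm g.
Proof. by rewrite mem_imset ?Alt_even //; apply: transf_of_perm_inj. Qed.

Lemma even_transf_sub s : s \in even_transf T -> s \in perm_transf T.
Proof. by case/imsetP=> g _ ->; apply: transf_of_perm_in. Qed.

(** On a finite set a composite is bijective only if both factors are, so the
    non-permutations form an ideal. *)
Lemma perm_transfM s t :
  (s * t \in perm_transf T) = (s \in perm_transf T) && (t \in perm_transf T).
Proof.
rewrite !mem_perm_transf.
apply/injectiveP/andP=> [inj_st | [/injectiveP inj_s]].
  have inj_s: injective s.
    by move=> x y eq_xy; apply: inj_st; rewrite !transfM eq_xy.
  split; apply/injectiveP=> // x y.
  have [s' _ s'K] := injF_bij inj_s.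
  by rewrite -(s'K x) -(s'K y) -!transfM => /inj_st ->.
by move/injectiveP=> inj_t x y; rewrite !transfM => /inj_t/inj_s.
Qed.

Lemma transf_one_perm : (1 : transf T) \in perm_transf T.
Proof. by rewrite -transf_of_perm1 transf_of_perm_in. Qed.

Lemma perm_transf_idem s : s \in perm_transf T -> s * s = s -> s = 1.
Proof.
rewrite mem_perm_transf => /injectiveP inj_s /ffunP idem_s.
apply/ffunP=> x; rewrite transf1; apply: inj_s.
by rewrite -transfM idem_s.
Qed.

Definition const_transf x : transf T := [ffun _ => x].

Lemma const_transfM x s : const_transf x * s = const_transf (s x).
Proof. by apply/ffunP=> y; rewrite transfM !ffunE. Qed.

Lemma transfM_const s x : s * const_transf x = const_transf x.
Proof. by apply/ffunP=> y; rewrite transfM !ffunE. Qed.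

Lemma const_transf_notin x : 1 < #|T| -> const_transf x \notin perm_transf T.
Proof.
rewrite mem_perm_transf => /card_gt1P[y [z [_ _ neq_yz]]].
by apply/injectiveP=> inj_c; case/eqP: neq_yz; apply: inj_c; rewrite !ffunE.
Qed.

(** For r = [:: y] with y != z these are the idempotents of rank #|T| - 1, and
    for r an enumeration of T the constant map at z; general r interpolates
    between them by induction. *)
Definition collapse z (r : seq T) : transf T :=
  [ffun x => if x \in r then z else x].

Lemma collapse_nil z : collapse z [::] = 1.
Proof. by apply/ffunP=> x; rewrite !ffunE. Qed.

Lemma collapse_enum z : collapse z (enum T) = const_transf z.
Proof. by apply/ffunP=> x; rewrite !ffunE mem_enum. Qed.

Lemma collapse_cons z r y :
  collapse z (y :: r) = collapse z [:: y] * collapse z r.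
Proof.
apply/ffunP=> x; rewrite transfM !ffunE !inE.
by case: eqVneq => //= _; case: ifP.
Qed.

Lemma collapse_absorb y z s : s y = s z -> collapse z [:: y] * s = s.
Proof.
move=> eq_s; apply/ffunP=> x; rewrite transfM !ffunE !inE.
by case: eqVneq => // ->.
Qed.

Lemma collapse_conj y z g :
  transf_of_perm g * collapse (g z) [:: g y] =
  collapse z [:: y] * transf_of_perm g.
Proof.
apply/ffunP=> x; rewrite !transfM !ffunE !inE (inj_eq perm_inj).
by case: eqP.
Qed.

(** The alternating group is (#|T| - 2)-transitive. *)
Lemma Alt_2transitive x y x' y' :
    3 < #|T| -> x != y -> x' != y' ->
  exists h, [/\ ~~ odd_perm h, h x = x' & h y = y'].
Proof.
move=> T_gt3 neq_xy neq_xy'.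
have trA: [transitive^2 'Alt_T, on setT | 'P].
  by apply: ntransitive_weak (Alt_trans T); rewrite -subn2 ltn_subRL.
have dtup u v : u != v -> [tuple u; v] \in dtuple_on 2 [set: T].
  by move=> neq_uv; rewrite inE /= inE neq_uv; apply/subsetP=> w; rewrite inE.
have [h hA /(congr1 val)[-> ->]] :=
  atransP2 trA (dtup _ _ neq_xy) (dtup _ _ neq_xy').
by exists h; rewrite -Alt_even.
Qed.

End Transformations.

(** * The non-injective endomorphisms *)

Section Endomorphisms.
Variables (n : nat) (hn : 5 <= n).
Implicit Types (s t e : Tn n) (g h : {perm 'I_n}) (x y : 'I_n)
  (a b : transf (Tn n)).

Let T_gt1 : 1 < #|'I_n|. Proof. by rewrite card_ord (leq_trans _ hn). Qed.
Let T_gt3 : 3 < #|'I_n|. Proof. by rewrite card_ord (leq_trans _ hn). Qed.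

Lemma exists_neq2 x y : exists z, (z != x) && (z != y).
Proof.
case: (set_0Vmem (~: [set x; y])) => [A0 | [z]]; last first.
  by rewrite !inE negb_or; exists z.
have /eqP := cardsC [set x; y]; rewrite A0 cards0 addn0 cards2.
by move=> /eqP card_xy; move: T_gt3; rewrite -card_xy; case: (x != y).
Qed.

Lemma End_P a :
  reflect {morph a : s t / s * t} (a \in End_T n).
Proof.
rewrite inE; apply: (iffP forallP) => [aM s t | aM s].
  by have /forallP/(_ t)/eqP := aM s.
by apply/forallP=> t; rewrite aM.
Qed.

(** If a s = a t while s x != t x, left multiplication by the constant x shows
    that a identifies two distinct constants; a map sending their values to i
    and j carries this to any two constants. *)
Lemma End_constant a : a \in End_T n -> ~~ injectiveb a ->
  exists e, forall x, a (const_transf x) = e.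
Proof.
move/End_P=> aM /injectivePn[s [t neq_st eq_a]].
have [x neq_x]: exists x, s x != t x.
  apply/existsP; apply: contraR neq_st; rewrite negb_exists => /forallP eq_st.
  by apply/eqP/ffunP=> x; apply/eqP; rewrite -[_ == _]negbK eq_st.
have eq_c i j : a (const_transf i) = a (const_transf j).
  pose u : Tn n := [ffun w => if w == s x then i else j].
  have ->: const_transf i = const_transf x * s * u.
    by rewrite !const_transfM ffunE eqxx.
  have ->: const_transf j = const_transf x * t * u.
    by rewrite !const_transfM ffunE eq_sym (negPf neq_x).
  by rewrite !aM eq_a.
by exists (a (const_transf x)) => y; apply: eq_c.
Qed.

(** Each a g permutes the fixed points of the idempotent a 1; extended by the
    identity it becomes a permutation P g of 'I_n which determines a g.  If a
    were injective on the symmetric group then P would be a bijection of that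
    group, yet every P g fixes the points in the image of the zero e. *)
Lemma End_noninj_perm a e : a \in End_T n ->
    (forall x, a (const_transf x) = e) ->
  ~ injective (fun g => a (transf_of_perm g)).
Proof.
move/End_P=> aM a_c a_inj.
pose f := a 1; pose ag g := a (transf_of_perm g).
have agf g x : f (ag g x) = ag g x by rewrite -transfM -aM mulg1.
have fag g x : ag g (f x) = ag g x by rewrite -transfM -aM mul1g.
have agV g x : ag g^-1 (ag g x) = f x.
  by rewrite -transfM -aM -transf_of_permM mulgV transf_of_perm1.
pose p g x := if f x == x then ag g x else x.
have p_inj g : injective (p g).
  move=> x y; rewrite /p.
  case: ifP => [/eqP fx | f'x]; case: ifP => [/eqP fy | f'y] //.
  - by move/(congr1 (ag g^-1)); rewrite !agV fx fy.
  - by move=> eq_xy; rewrite -eq_xy agf eqxx in f'y.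
  by move=> eq_xy; rewrite eq_xy agf eqxx in f'x.
pose P g := perm (p_inj g).
have P_inj : injective P.
  move=> g h /permP eqP; apply: a_inj; apply/ffunP=> x.
  have := eqP (f x); rewrite !permE /p -transfM -aM mulg1 eqxx.
  by rewrite -/(ag g) -/(ag h) !fag.
have [P' _ P'K] := injF_bij P_inj.
have /card_gt0P[x0 _] := ltnW T_gt1.
have [j /andP[neq_j _]] := exists_neq2 (e x0) (e x0).
have ea s x : a s (e x) = e x.
  by rewrite -(a_c x0) -transfM -aM const_transfM !a_c.
have := P'K (tperm (e x0) j) => /permP/(_ (e x0)).
rewrite permE /p /f /ag !ea if_same tpermL => eq_j.
by rewrite eq_j eqxx in neq_j.
Qed.

Definition End_kernel a := [set g | a (transf_of_perm g) == a 1].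

Lemma End_kernel_group a : a \in End_T n -> group_set (End_kernel a).
Proof.
move/End_P=> aM; apply/group_setP; split=> [|g h].
  by rewrite inE transf_of_perm1.
by rewrite !inE transf_of_permM aM => /eqP-> /eqP->; rewrite -aM mulg1.
Qed.

Lemma End_kernel_conj a g h : a \in End_T n ->
  g \in End_kernel a -> g ^ h \in End_kernel a.
Proof.
move/End_P=> aM; rewrite !inE conjgE !transf_of_permM !aM => /eqP->.
by rewrite -!aM mul1g -transf_of_permM mulVg transf_of_perm1.
Qed.

(** The kernel is normal in the symmetric group and contains some g != 1.  A
    commutator of g with an even h not commuting with it lies both in the
    kernel and in the alternating group, which is simple. *)
Lemma Alt_sub_End_kernel a : a \in End_T n -> ~~ injectiveb a ->
  'Alt_('I_n) \subset End_kernel a.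
Proof.
move=> aE a_ninj; have [e a_c] := End_constant aE a_ninj.
have /End_P aM := aE.
pose K := group (End_kernel_group aE).
have [g gK g_neq1]: exists2 g, g \in K & g != 1.
  apply/exists_inP; apply: contra_notT (End_noninj_perm aE a_c).
  rewrite negb_exists_in => /forall_inP K1 g h eq_gh.
  have: g * h^-1 \in K.
    rewrite inE transf_of_permM aM eq_gh -aM -transf_of_permM mulgV.
    by rewrite transf_of_perm1.
  by move/K1; rewrite negbK => /eqP eq1; rewrite -(mulgKV h g) eq1 mul1g.
(* An even h that fixes x and moves g x does not commute with g. *)
have [x gx]: exists x, g x != x.
  apply/existsP; apply: contraR g_neq1; rewrite negb_exists => /forallP g1.
  by apply/eqP/permP=> x; apply/eqP; rewrite perm1 -[_ == _]negbK g1.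
have [z /andP[zx zgx]] := exists_neq2 x (g x).
have [h [h_even hx hgx]]: exists h, [/\ ~~ odd_perm h, h x = x & h (g x) = z].
  by apply: Alt_2transitive; rewrite // eq_sym.
have hA: h \in 'Alt_('I_n) by rewrite Alt_even.
have gA: [~ g, h] \in 'Alt_('I_n).
  by rewrite Alt_even commgEl odd_permM odd_permJ odd_permV addbb.
have ghK: [~ g, h] \in K.
  by rewrite commgEl groupM ?groupV // End_kernel_conj.
have gh_neq1: [~ g, h] != 1.
  rewrite commgEl -eq_mulVg1; apply: contra zgx => /eqP/permP/(_ x) ->.
  by rewrite -hx permJ hgx.
have nKA: K :&: 'Alt_('I_n) <| 'Alt_('I_n).
  rewrite /normal subsetIr normsI ?normG //.
  apply/subsetP=> k _; rewrite inE; apply/subsetP=> _ /imsetP[l lK ->].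
  exact: End_kernel_conj.
have /simpleP[_ simA] : simple 'Alt_('I_n) by rewrite simple_Alt5 // card_ord.
have [KA1 | <-] := simA (K :&: 'Alt_('I_n))%G nKA; last exact: subsetIl.
have: [~ g, h] \in K :&: 'Alt_('I_n) by rewrite inE ghK.
by rewrite KA1 inE (negPf gh_neq1).
Qed.

Lemma End_even a g : a \in End_T n -> ~~ injectiveb a -> ~~ odd_perm g ->
  a (transf_of_perm g) = a 1.
Proof.
move=> aE a_ninj; rewrite -Alt_even.
by move/(subsetP (Alt_sub_End_kernel aE a_ninj)); rewrite inE => /eqP.
Qed.

(** If s y = s z then s absorbs on its left the idempotent that sends y to z.
    Since A_n is 2-transitive and lies in the kernel, all such idempotents have
    the same image, hence a s absorbs the image of each of them. *)
Lemma End_nonperm a : a \in End_T n -> ~~ injectiveb a ->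
  exists e, forall s, s \notin perm_transf 'I_n -> a s = e.
Proof.
move=> aE a_ninj; have [e a_c] := End_constant aE a_ninj.
have /End_P aM := aE; exists e => s.
rewrite mem_perm_transf => /injectivePn[y [z neq_yz eq_s]].
have eq_d y' z' : y' != z' -> a (collapse z' [:: y']) = a (collapse z [:: y]).
  move=> neq_yz'.
  have [h [h_even <- <-]] := Alt_2transitive T_gt3 neq_yz neq_yz'.
  have /(congr1 a) := collapse_conj y z h.
  by rewrite !aM (End_even aE a_ninj h_even) -!aM mul1g mulg1.
have d_s y' z' : a (collapse z' [:: y'] * s) = a s.
  have [-> | neq_yz'] := eqVneq y' z'; first by rewrite collapse_absorb.
  by rewrite aM eq_d // -aM collapse_absorb.
have all_s r : a (collapse z r * s) = a s.
  elim: r => [|w r IHr]; first by rewrite collapse_nil mul1g.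
  by rewrite collapse_cons -mulgA aM IHr -aM d_s.
by rewrite -(all_s (enum 'I_n)) collapse_enum const_transfM.
Qed.

Lemma phi_of_perm t e g :
  phi t e (transf_of_perm g) = if odd_perm g then t else t * t.
Proof.
by rewrite ffunE inE mem_even_transf transf_of_perm_in andbT; case: odd_perm.
Qed.

Lemma phi_nonperm t e s : s \notin perm_transf 'I_n -> phi t e s = e.
Proof.
move=> s_np; rewrite ffunE inE (negPf s_np) andbF.
by rewrite (negPf (contra (@even_transf_sub _ s) s_np)).
Qed.

Lemma phi_1 t e : phi t e 1 = t * t.
Proof. by rewrite -transf_of_perm1 phi_of_perm odd_perm1. Qed.

Lemma exists_odd : exists g, odd_perm g.
Proof.
have /card_gt1P[x [y [_ _ neq_xy]]] := T_gt1.
by exists (tperm x y); rewrite odd_tperm.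
Qed.

Lemma exists_nonperm : exists x, const_transf x \notin perm_transf 'I_n.
Proof.
by have /card_gt0P[x _] := ltnW T_gt1; exists x; apply: const_transf_notin.
Qed.

(** The singular part of the theorem of Schein and Teclezghi. *)
Theorem End_noninj_phi a : a \in End_T n -> ~~ injectiveb a ->
  exists t e, a = phi t e.
Proof.
move=> aE a_ninj; have [e a_np] := End_nonperm aE a_ninj.
have /End_P aM := aE; have [g0 g0_odd] := exists_odd.
pose t := a (transf_of_perm g0).
have a_odd g : odd_perm g -> a (transf_of_perm g) = t.
  move=> g_odd; rewrite -(mulgKV g0 g) transf_of_permM aM.
  by rewrite End_even ?odd_permM ?odd_permV ?g_odd ?g0_odd // -aM mul1g.
exists t, e; apply/ffunP=> s.
have [/imsetP[g _ ->]|s_np] := boolP (s \in perm_transf 'I_n).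
  rewrite phi_of_perm; have [g_odd|g_even] := boolP (odd_perm g).
    exact: a_odd.
  rewrite -aM -transf_of_permM (End_even aE a_ninj g_even).
  by rewrite End_even // odd_permM addbb.
by rewrite phi_nonperm ?a_np.
Qed.

Lemma phi_EndP t e :
  reflect [/\ t * t * t = t, t * e = e, e * t = e & e * e = e]
          (phi t e \in End_T n).
Proof.
apply: (iffP (End_P _)) => [aM | [ttt te et ee] s s'].
  have [g g_odd] := exists_odd; have [x c_np] := exists_nonperm.
  have:= (aM (transf_of_perm g) 1, aM (transf_of_perm g) (const_transf x),
    aM (const_transf x) (transf_of_perm g),
    aM (const_transf x) (const_transf x)).
  rewrite mulg1 !transfM_const const_transfM.
  rewrite !(phi_of_perm, phi_1, phi_nonperm) ?g_odd // ?const_transf_notin //.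
  by case=> [[[? ?] ?] ?]; rewrite -mulgA.
have [/imsetP[g _ ->]|s_np] := boolP (s \in perm_transf 'I_n);
  have [/imsetP[h _ ->]|s'_np] := boolP (s' \in perm_transf 'I_n).
- rewrite -transf_of_permM !phi_of_perm odd_permM.
  by case: (odd_perm g); case: (odd_perm h); rewrite //= mulgA ttt.
- rewrite phi_of_perm !phi_nonperm ?perm_transfM ?negb_and ?s'_np ?orbT //.
  by case: ifP; rewrite // -mulgA !te.
- rewrite phi_of_perm !phi_nonperm ?perm_transfM ?negb_and ?s_np //.
  by case: ifP; rewrite // mulgA !et.
by rewrite !phi_nonperm ?perm_transfM ?negb_and ?s_np.
Qed.

(** * The idempotent endomorphisms *)

Lemma phi_odd t e s :
  s \in perm_transf 'I_n :\: even_transf 'I_n -> phi t e s = t.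
Proof. by rewrite ffunE => ->. Qed.

Lemma odd_transf_perm s :
  s \in perm_transf 'I_n :\: even_transf 'I_n -> s \in perm_transf 'I_n.
Proof. by case/setDP. Qed.

Lemma one_notin_odd : (1 : Tn n) \notin perm_transf 'I_n :\: even_transf 'I_n.
Proof. by rewrite inE -transf_of_perm1 mem_even_transf odd_perm1. Qed.

Lemma idem_nonperm e : e * e = e -> e != 1 -> e \notin perm_transf 'I_n.
Proof. by move=> ee; apply: contra => /perm_transf_idem/(_ ee)->. Qed.

Lemma phi_noninj t e : ~~ injectiveb (phi t e).
Proof.
have /card_gt1P[x [y [_ _ neq_xy]]] := T_gt1.
apply/injectivePn; exists (const_transf x), (const_transf y).
  by apply: contra neq_xy => /eqP/ffunP/(_ x); rewrite !ffunE => ->.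
by rewrite !phi_nonperm ?const_transf_notin.
Qed.

Lemma singularE a :
  (a \in End_T n :\: Aut_T n) = (a \in End_T n) && ~~ injectiveb a.
Proof.
rewrite in_setD in_setI mem_perm_transf.
by case: (a \in End_T n); rewrite ?andbT ?andbF.
Qed.

Lemma End_M a b : a \in End_T n -> b \in End_T n -> a * b \in End_T n.
Proof.
by move=> /End_P aM /End_P bM; apply/End_P=> s t; rewrite !transfM aM bM.
Qed.

Lemma End_1 : 1 \in End_T n.
Proof. by apply/End_P=> s t; rewrite !transf1. Qed.

Lemma phi_mul t e b : b \in End_T n -> phi t e * b = phi (b t) (b e).
Proof.
move/End_P=> bM; apply/ffunP=> s; rewrite transfM.
have [/imsetP[g _ ->]|s_np] := boolP (s \in perm_transf 'I_n).
  by rewrite !phi_of_perm -bM; case: ifP.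
by rewrite !phi_nonperm.
Qed.

Lemma phi_const e s : e * e = e -> phi e e s = e.
Proof. by move=> ee; rewrite ffunE ee !if_same. Qed.

Lemma E1P a : reflect (exists2 e, e * e = e & a = phi e e) (a \in E1 n).
Proof.
rewrite inE; apply: (iffP andP) => [[aE /existsP[e /eqP a_phi]]|[e ee ->]].
  by exists e => //; move: aE; rewrite a_phi => /phi_EndP[].
by split; [apply/phi_EndP; rewrite !ee | apply/existsP; exists e].
Qed.

Lemma E2P a :
  reflect (exists e, [/\ e * e = e, e != 1 & a = phi 1 e]) (a \in E2 n).
Proof.
rewrite inE; apply: (iffP andP) => [[aE /existsP[e /andP[e1 /eqP a_phi]]]|].
  by exists e; split=> //; move: aE; rewrite a_phi => /phi_EndP[].
case=> e [ee e1 ->]; split; last by apply/existsP; exists e; rewrite e1 /=.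
by apply/phi_EndP; rewrite !mulg1 mul1g.
Qed.

Lemma E3P a :
  reflect (exists t e, [/\ t \in perm_transf 'I_n :\: even_transf 'I_n,
                           e != 1, phi t e \in End_T n & a = phi t e])
          (a \in E3 n).
Proof.
rewrite inE; apply: (iffP andP) => [[aE]|[t [e [t_odd e1 tE ->]]]].
  case/existsP=> t /existsP[e /and3P[t_odd e1 /eqP a_phi]].
  by exists t, e; split; rewrite -?a_phi.
by split=> //; apply/existsP; exists t; apply/existsP; exists e; apply/and3P.
Qed.

(** A uniform description of the three families: when e = 1, the relation te = e
    forces t = 1, and then [phi t e] is in E1; when e != 1, the three cases on t
    give E3, E2 and E1 in turn. *)
Lemma singular_idemP a :
  reflect (exists t e, [/\ phi t e \in End_T n, a = phi t e &
             [\/ t \in perm_transf 'I_n :\: even_transf 'I_n, t = 1 | t = e]])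
          (a \in E3 n :|: E2 n :|: E1 n).
Proof.
rewrite !in_setU -orbA; apply: (iffP or3P) => [[/E3P|/E2P|/E1P]|].
- by case=> t [e [t_odd e1 tE ->]]; exists t, e; split=> //; apply: Or31.
- case=> e [ee e1 ->]; exists 1, e; split=> //; last exact: Or32.
  by apply/phi_EndP; rewrite !mulg1 mul1g.
- case=> e ee ->; exists e, e; split=> //; last exact: Or33.
  by apply/phi_EndP; rewrite !ee.
case=> t [e [tE -> t_kind]]; have /phi_EndP[_ te _ ee] := tE.
have [e1|e_neq1] := eqVneq e 1.
  have t1: t = 1 by rewrite -(mulg1 t) -{1}e1 te.
  by apply/Or33/E1P; exists 1; rewrite ?mulg1 // t1 e1.
case: t_kind => [t_odd | -> | ->].
- by apply/Or31/E3P; exists t, e.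
- by apply/Or32/E2P; exists e.
by apply/Or33/E1P; exists e.
Qed.

Lemma singular_idem_End a :
  a \in E3 n :|: E2 n :|: E1 n -> (a \in End_T n) && ~~ injectiveb a.
Proof. by case/singular_idemP=> t [e [tE -> _]]; rewrite tE phi_noninj. Qed.

Lemma perm_transf_sqr1 t : t \in perm_transf 'I_n -> t * t * t = t -> t * t = 1.
Proof.
move=> t_perm ttt; apply: perm_transf_idem; last by rewrite mulgA ttt.
by rewrite perm_transfM t_perm.
Qed.

(** By [phi_mul], a = phi t e is idempotent iff a fixes t and e, and a t is t,
    t^2 or e according as t is odd, even or not a permutation. *)
Lemma singular_idemE :
  [set a in End_T n :\: Aut_T n | a * a == a] = E3 n :|: E2 n :|: E1 n.
Proof.
apply/setP=> a; rewrite [LHS]inE singularE.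
apply/andP/idP=> [[/andP[aE a_ninj] /eqP aa] | a_sing].
  have [t [e a_phi]] := End_noninj_phi aE a_ninj.
  have [g g_odd] := exists_odd.
  have at_t: a t = t.
    have at_g: a (transf_of_perm g) = t by rewrite a_phi phi_of_perm g_odd.
    by rewrite -{1}at_g -transfM aa.
  apply/singular_idemP; exists t, e; split; rewrite -?a_phi //.
  have [t_perm|t_np] := boolP (t \in perm_transf 'I_n); last first.
    by apply: Or33; rewrite -at_t a_phi phi_nonperm.
  have [t_odd|] := boolP (t \in perm_transf 'I_n :\: even_transf 'I_n).
    exact: Or31.
  rewrite inE t_perm andbT negbK => t_even; apply/Or32/perm_transf_idem => //.
  by rewrite -{3}at_t a_phi ffunE inE t_even.
split; first exact: singular_idem_End.
case/singular_idemP: a_sing => t [e [tE -> t_kind]].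
have /phi_EndP[ttt te et ee] := tE.
rewrite phi_mul //; apply/eqP; case: t_kind => [t_odd|t1|te_eq].
- rewrite phi_odd // phi_nonperm //; apply: idem_nonperm => //.
  apply: contraTneq t_odd => e1.
  by rewrite -(mulg1 t) -{1}e1 te e1 one_notin_odd.
- rewrite {}t1 phi_1 mulg1; congr (phi 1 _).
  have [->|e1] := eqVneq e 1; first by rewrite phi_1 mulg1.
  by rewrite phi_nonperm // idem_nonperm.
by rewrite te_eq !phi_const.
Qed.

Lemma E3_left_identity a b : a \in E3 n ->
  b \in End_T n -> ~~ injectiveb b -> a * b = b.
Proof.
case/E3P=> t [e [t_odd e1 /phi_EndP[_ _ _ ee] ->]] bE b_ninj.
rewrite phi_mul //; have [t' [e' ->]] := End_noninj_phi bE b_ninj.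
by rewrite phi_odd // phi_nonperm // idem_nonperm.
Qed.

Lemma E1_right_zero a b : a \in End_T n -> b \in E1 n -> a * b = b.
Proof.
by move=> aE /E1P[e ee ->]; apply/ffunP=> s; rewrite transfM !phi_const.
Qed.

Lemma E1_mulr a b : a \in E1 n -> b \in End_T n -> a * b \in E1 n.
Proof.
case/E1P=> e ee -> bE; rewrite phi_mul //; apply/E1P; exists (b e) => //.
by have /End_P bM := bE; rewrite -bM ee.
Qed.

Lemma E2_mul_phi a t e : a \in E2 n -> phi t e \in End_T n -> t * t = 1 ->
  a * phi t e = phi 1 e.
Proof.
case/E2P=> e' [ee' e'1 ->] tE tt; rewrite phi_mul // phi_1 tt phi_nonperm //.
exact: idem_nonperm.
Qed.

Lemma E2_right_zero a b : a \in E2 n -> b \in E2 n -> a * b = b.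
Proof.
move=> aE2 /E2P[e [ee e1 ->]]; apply: E2_mul_phi; rewrite ?mulg1 //.
by apply/phi_EndP; rewrite !mulg1 mul1g.
Qed.

Lemma E2_mul_E3 a b : a \in E2 n -> b \in E3 n -> a * b \in E2 n.
Proof.
move=> aE2 /E3P[t [e [t_odd e1 tE ->]]]; have /phi_EndP[ttt _ _ ee] := tE.
rewrite (E2_mul_phi aE2 tE (perm_transf_sqr1 (odd_transf_perm t_odd) ttt)).
by apply/E2P; exists e.
Qed.

(** The product a * b is not injective, hence equals some phi t' e' where t' and
    e' belong to the image {t, t^2, e} of b; idempotency of e' and t'e' = e'
    exclude the pairs outside the list of [singular_idemP]. *)
Lemma singular_idem_left_ideal :
  left_ideal_of (End_T n) (E3 n :|: E2 n :|: E1 n).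
Proof.
split=> [||a b aE].
- have [x _] := exists_nonperm; exists (phi (const_transf x) (const_transf x)).
  rewrite in_setU orbC; apply/orP; left; apply/E1P.
  exists (const_transf x) => //.
  by rewrite transfM_const.
- by move=> a /singular_idem_End/andP[].
move=> b_sing; have /andP[bE b_ninj] := singular_idem_End b_sing.
have abE := End_M aE bE.
have ab_ninj: ~~ injectiveb (a * b).
  rewrite -mem_perm_transf perm_transfM negb_and orbC.
  by rewrite [b \in _]mem_perm_transf b_ninj.
have [t' [e' ab_phi]] := End_noninj_phi abE ab_ninj.
have [g g_odd] := exists_odd; have [x c_np] := exists_nonperm.
apply/singular_idemP; exists t', e'; split; rewrite -?ab_phi //.
move: abE; rewrite ab_phi => /phi_EndP[_ te' _ ee'].
have: b (a (transf_of_perm g)) = t'.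
  by rewrite -transfM ab_phi phi_of_perm g_odd.
have: b (a (const_transf x)) = e' by rewrite -transfM ab_phi phi_nonperm.
have t'1 : e' = 1 -> t' = 1 by move=> e'1; rewrite -(mulg1 t') -{1}e'1 te'.
case/singular_idemP: b_sing => t [e [/phi_EndP[ttt te _ ee] -> t_kind]].
have im_phi s: [\/ phi t e s = t, phi t e s = t * t | phi t e s = e].
  rewrite ffunE; case: ifP => _; first exact: Or31.
  by case: ifP => _; [apply: Or32 | apply: Or33].
case: t_kind => [t_odd|t1|te_eq].
- have tt := perm_transf_sqr1 (odd_transf_perm t_odd) ttt; rewrite tt in im_phi.
  case: (im_phi (a (const_transf x))) => -> e'_eq.
  + move: ee'; rewrite -e'_eq tt => t1.
    by rewrite -t1 (negPf one_notin_odd) in t_odd.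
  + by move=> _; apply: Or32; rewrite t'1.
  case: (im_phi (a (transf_of_perm g))) => -> <-; [exact: Or31 | exact: Or32 |].
  exact: Or33.
- rewrite t1 mulg1 in im_phi *.
  case: (im_phi (a (const_transf x))) => -> e'_eq;
    try by move=> _; apply: Or32; rewrite t'1.
  case: (im_phi (a (transf_of_perm g))) => -> <-; [exact: Or32 | exact: Or32 |].
  exact: Or33.
by rewrite te_eq !phi_const // => <- <-; apply: Or33.
Qed.

(** Elements of E1 are right zeros, so E1 is contained in every ideal. *)
Lemma E1_minimal_ideal (I : {set transf (Tn n)}) :
  minimal_ideal_of (End_T n) I <-> I = E1 n.
Proof.
have E1sub: {subset E1 n <= End_T n}.
  move=> a /(subsetP (subsetUr (E3 n :|: E2 n) _)).
  by case/singular_idem_End/andP.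
have E1ideal: ideal_of (End_T n) (E1 n).
  split=> //.
  - have [x _] := exists_nonperm.
    exists (phi (const_transf x) (const_transf x)).
    by apply/E1P; exists (const_transf x); rewrite ?transfM_const.
  - by move=> a x aE xE1; rewrite E1_right_zero.
  by move=> a x aE xE1; apply: E1_mulr.
have E1min (J : {pred transf (Tn n)}) :
    ideal_of (End_T n) J -> {subset E1 n <= J}.
  case=> [[x xJ] JE _ Jr] c cE1.
  by rewrite -(E1_right_zero (JE x xJ) cE1); apply: Jr => //; apply: E1sub.
split=> [[Iideal Imin] | ->].
  by apply/setP=> a; rewrite (Imin _ E1ideal (E1min _ Iideal)).
split=> // J Jideal J_E1 a; apply/idP/idP; first exact: J_E1.
exact: E1min.
Qed.

(** * The chain of components *)

Local Notation idset := [set (1 : transf (Tn n))].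

Lemma E_componentE (i : 'I_4) :
  E_component n i = nth set0 [:: E1 n; E2 n; E3 n; idset] i.
Proof. exact: tnth_nth. Qed.

Lemma mem_E_component a :
  reflect (exists i, a \in E_component n i)
          (a \in idset :|: E3 n :|: E2 n :|: E1 n).
Proof.
rewrite !in_setU -!orbA; apply: (iffP or4P) => [|[[[|[|[|[|//]]]] lt_i]]].
- by case=> aE; [exists (@Ordinal 4 3 isT) | exists (@Ordinal 4 2 isT)
                | exists (@Ordinal 4 1 isT) | exists (@Ordinal 4 0 isT)];
    rewrite E_componentE.
- by rewrite E_componentE; apply: Or44.
- by rewrite E_componentE; apply: Or43.
- by rewrite E_componentE; apply: Or42.
by rewrite E_componentE; apply: Or41.
Qed.

Lemma singular_idem_sub :
  [/\ {subset E1 n <= [pred a | (a \in End_T n) && ~~ injectiveb a]},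
      {subset E2 n <= [pred a | (a \in End_T n) && ~~ injectiveb a]} &
      {subset E3 n <= [pred a | (a \in End_T n) && ~~ injectiveb a]}].
Proof.
by split=> a aEk; apply: singular_idem_End; rewrite !in_setU aEk ?orbT.
Qed.

(** Below the identity, the components interact through the right zeros of E1,
    the left identities of E3, and a direct computation for E2 times E3. *)
Lemma E_component_mul (i j : 'I_4) a b : i <= j ->
    a \in E_component n i -> b \in E_component n j ->
  (a * b \in E_component n i) && (b * a \in E_component n i).
Proof.
have [E1s E2s E3s] := singular_idem_sub.
case: j => [[|[|[|[|//]]]] lt_j] le_ij aEi bEj; last first.
  by move: bEj; rewrite E_componentE inE => /eqP->; rewrite mulg1 mul1g aEi.
all: move: le_ij aEi bEj; case: i => [[|[|[|[|//]]]] lt_i] // _.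
all: rewrite !E_componentE /= => aEi bEj.
- have /andP[bE _] := E3s _ bEj.
  by rewrite E1_mulr // E1_right_zero.
- have /andP[aE a_ninj] := E2s _ aEi.
  by rewrite E2_mul_E3 // E3_left_identity.
- have [/andP[aE a_ninj] /andP[bE b_ninj]] := (E3s _ aEi, E3s _ bEj).
  by rewrite !E3_left_identity ?aEi ?bEj.
- have /andP[bE _] := E2s _ bEj.
  by rewrite E1_mulr // E1_right_zero.
- by rewrite !E2_right_zero ?aEi ?bEj.
have [/andP[aE _] /andP[bE _]] := (E1s _ aEi, E1s _ bEj).
by rewrite !E1_right_zero ?aEi ?bEj.
Qed.

Lemma E_component_right_zero (i : 'I_4) a b :
  a \in E_component n i -> b \in E_component n i -> a * b = b.
Proof.
have [E1s E2s E3s] := singular_idem_sub; rewrite E_componentE.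
case: i => [[|[|[|[|//]]]] lt_i] /= aEi bEi.
- by rewrite E1_right_zero //; have /andP[] := E1s _ aEi.
- exact: E2_right_zero.
- by have /andP[bE b_ninj] := E3s _ bEi; rewrite E3_left_identity.
by move: aEi; rewrite inE => /eqP->; rewrite mul1g.
Qed.

Lemma E_component_nonempty (i : 'I_4) : exists a, a \in E_component n i.
Proof.
have /card_gt1P[x [y [_ _ neq_xy]]] := T_gt1.
have [z /andP[zx zy]] := exists_neq2 x y.
have c_np w := const_transf_notin w T_gt1.
have c_idem (w : 'I_n) : const_transf w * const_transf w = const_transf w.
  by rewrite transfM_const.
have c_neq1 (w : 'I_n) : const_transf w != 1.
  by apply: contra (c_np w) => /eqP->; apply: transf_one_perm.
case: i => [[|[|[|[|//]]]] lt_i].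
- exists (phi (const_transf z) (const_transf z)); rewrite E_componentE.
  by apply/E1P; exists (const_transf z).
- exists (phi 1 (const_transf z)); rewrite E_componentE.
  by apply/E2P; exists (const_transf z).
- pose t := transf_of_perm (tperm x y); exists (phi t (const_transf z)).
  rewrite E_componentE; apply/E3P; exists t, (const_transf z); split=> //.
    by rewrite inE transf_of_perm_in mem_even_transf odd_tperm neq_xy.
  apply/phi_EndP; rewrite -!transf_of_permM tperm2 mul1g; split=> //.
    by rewrite transfM_const.
  by rewrite const_transfM ffunE tpermD // eq_sym.
by exists 1; rewrite E_componentE inE.
Qed.

(** The index of a component can be read off the values of its elements at the
    identity, at an odd permutation and at a constant map. *)
Lemma E_component_disjoint (i j : 'I_4) a :
  a \in E_component n i -> a \in E_component n j -> i = j.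
Proof.
have [g g_odd] := exists_odd; have [x c_np] := exists_nonperm.
pose level b : nat := if injectiveb b then 3
  else if b (transf_of_perm g) != b 1 then 2
  else (b (const_transf x) != b 1 : nat).
suff levelE (k : 'I_4) : a \in E_component n k -> level a = k.
  by move=> /levelE ai /levelE aj; apply/val_inj; rewrite /= -ai.
rewrite E_componentE; case: k => [[|[|[|[|//]]]] lt_k] /=.
- case/E1P=> e ee ->; rewrite /level (negPf (phi_noninj e e)).
  by rewrite !phi_const // eqxx.
- case/E2P=> e [ee e1 ->]; rewrite /level (negPf (phi_noninj 1 e)).
  by rewrite phi_of_perm g_odd phi_1 mulg1 eqxx phi_nonperm // e1.
- case/E3P=> t [e [t_odd _ /phi_EndP[ttt _ _ _] ->]].
  rewrite /level (negPf (phi_noninj t e)) phi_of_perm g_odd phi_1.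
  rewrite (perm_transf_sqr1 (odd_transf_perm t_odd) ttt).
  by case: eqVneq t_odd => // ->; rewrite (negPf one_notin_odd).
by rewrite inE /level -mem_perm_transf => /eqP->; rewrite transf_one_perm.
Qed.

Lemma E_component_right_zero_semigroup (i : 'I_4) :
  right_zero_semigroup (E_component n i).
Proof.
split; first split; first exact: E_component_nonempty.
  by move=> a b aEi bEi; rewrite (E_component_right_zero aEi bEi).
by move=> b bEi; split=> // a aEi; apply: E_component_right_zero aEi bEi.
Qed.

Lemma E_chain :
  chain_of_subsemigroups (idset :|: E3 n :|: E2 n :|: E1 n)
    (fun i : 'I_4 => mem (E_component n i)).
Proof.
split=> [i | a | i j a | i j a b aEi bEj].
- by case: (E_component_right_zero_semigroup i).
- by split=> /mem_E_component.
- exact: E_component_disjoint.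
case: (leqP i j) => [le_ij | /ltnW le_ji].
  rewrite (Order.MeetTheory.meet_l (le_ij : (i <= j)%O)).
  by case/andP: (E_component_mul le_ij aEi bEj).
rewrite (Order.MeetTheory.meet_r (le_ji : (j <= i)%O)).
by case/andP: (E_component_mul le_ji bEj aEi).
Qed.

Lemma idem_EndE :
  [set a in End_T n | a * a == a] = idset :|: E3 n :|: E2 n :|: E1 n.
Proof.
have -> : idset :|: E3 n :|: E2 n :|: E1 n = idset :|: (E3 n :|: E2 n :|: E1 n).
  by rewrite !setUA.
rewrite -singular_idemE; apply/setP=> a; rewrite inE in_setU1 inE singularE.
have [-> | a_neq1] := eqVneq a 1; first by rewrite End_1 mulg1 eqxx.
case: (boolP (injectiveb a)) => [a_inj | _]; last by rewrite andbT.
rewrite andbF; apply/negbTE; apply: contra a_neq1 => /andP[_ /eqP aa].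
by apply/eqP/perm_transf_idem; rewrite ?mem_perm_transf.
Qed.

End Endomorphisms.

Theorem proposition3p4 (n : nat) (hn : (5 <= n)%N) :
  [/\ forall a, a \in E3 n -> left_identity_of (End_T n :\: Aut_T n) a,
      forall a, a \in E1 n -> right_zero_of (End_T n :\: Aut_T n) a,
      forall I : {set transf (Tn n)},
        minimal_ideal_of (End_T n) I <-> I = E1 n,
      [set a in End_T n :\: Aut_T n | a * a == a]
        = E3 n :|: E2 n :|: E1 n
      /\ left_ideal_of (End_T n) (E3 n :|: E2 n :|: E1 n) &
      let E := [set (1 : transf (Tn n))] :|: E3 n :|: E2 n :|: E1 n in
      [/\ [set a in End_T n | a * a == a] = E,
          band E,
          chain_of_subsemigroups E (fun i : 'I_4 => mem (E_component n i)) &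
          forall i : 'I_4, right_zero_semigroup (E_component n i)]].
Proof.
have [E1s _ E3s] := singular_idem_sub hn.
split=> [a aE3 | a aE1 | I | |].
- split=> [|b]; rewrite singularE; first exact: E3s.
  by case/andP; apply: E3_left_identity.
- split=> [|b]; rewrite singularE; first exact: E1s.
  by case/andP=> bE _; apply: E1_right_zero.
- exact: E1_minimal_ideal.
- by split; [apply: singular_idemE | apply: singular_idem_left_ideal].
move=> E; split; [exact: idem_EndE | | exact: E_chain |].
  have [_ memE _ mulE] := E_chain hn; split; first split.
  - by exists 1; rewrite !inE eqxx.
  - move=> a b /memE[i ai] /memE[j bj].
    by apply/memE; exists (Order.meet i j); apply: mulE.
  by move=> a; rewrite -[E](idem_EndE hn) inE => /andP[_ /eqP].
exact: E_component_right_zero_semigroup.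
Qed.
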